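(* Let $\Sigma$ be a finite alphabet. For every $k\in\mathbb{N}$, every $w\in\Sigma^*$ with $n = |w|$, and every $w' \in B(w,k)$, \[ C_{\mathrm{LZ77}}(w) \le 4\,\frac{k^{1/3} n^{2/3}}{p_2(w,w')} \qquad\text{and}\qquad C_{\mathrm{LZ77}}(w) \le \frac{k^{3/2}\sqrt{n}}{\sqrt{2}\, p_3(w,w')}, \] where a right-hand side is read as $+\infty$ when the corresponding fraction $p_2(w,w')$ or $p_3(w,w')$ is $0$.
   Context: For a word $w = w_1 \cdots w_n$ over a finite alphabet $\Sigma$, write $w[i:j] = w_i\cdots w_j$. The LZ77 factorization of $w$ is $w = P_1\cdots P_z$ computed greedily from left to right: if $w[1:m]$ has been parsed, the next phrase is the shortest non-empty prefix of $w[m+1:n]$ that does not occur as a contiguous substring of $w[1:m]$; if there is none, the next phrase is the whole remaining suffix. $C_{\mathrm{LZ77}}(w) = z$. For a phrase $P_i$, $l(P_i)$ and $r(P_i)$ denote its first and last positions in $w$. Hamming distance $\Delta(w,w') = |\{i: w_i\ne w'_i\}|$ and $B(w,k) = \{w'\in\Sigma^{|w|}: \Delta(w,w')\le k\}$. If $w = P_1\cdots P_z$ and $w' = Q_1\cdots Q_{z'}$ are the LZ77 factorizations, define \[ p_2(w,w') = \frac1z\bigl|\{ i : |\{ j : l(P_i)\le l(Q_j)\le r(P_i)\}| = 2\}\bigr|,\quad p_3(w,w') = \frac1z\bigl|\{ i : |\{ j : l(P_i)\le l(Q_j)\le r(P_i)\}| = 3\}\bigr|, \] i.e. the fraction of phrases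 of $w$ containing exactly two (resp. three) starting positions of phrases of $w'$. *)

(* Defs.v *)
From mathcomp Require Import all_boot all_order all_algebra.
From mathcomp Require Import all_classical all_reals all_analysis.

Set Implicit Arguments.
Unset Strict Implicit.
Unset Printing Implicit Defensive.

Import Order.TTheory GRing.Theory Num.Theory.
Local Open Scope ring_scope.

Section LZ77.
Local Open Scope nat_scope.
Variable T : eqType.
Implicit Types (u v w : seq T) (P Q : seq (seq T)).

(* [find] returns the index, in the list [1; ...; size v] of candidate lengths,
   of the first prefix of v that does not occur in u, and [size v] when every
   prefix occurs; in the latter case the phrase is the whole of v. *)
Definition phrase_length u v : nat :=
  minn (size v)
       (find (fun l => ~~ infix (take l v) u) (iota 1 (size v))).+1.

(* u is the parsed prefix and v the remaining suffix. Every phrase is non-empty,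
   so [size w] units of fuel are enough to parse the whole of w. *)
Fixpoint lz77_rec (fuel : nat) u v : seq (seq T) :=
  if fuel is fuel'.+1 then
    if v is [::] then [::] else
    let l := phrase_length u v in
    take l v :: lz77_rec fuel' (u ++ take l v) (drop l v)
  else [::].

Definition lz77 w : seq (seq T) := lz77_rec (size w) [::] w.

Definition C_LZ77 w : nat := size (lz77 w).

(* Phrases are indexed from 0, positions in the word from 1. *)
Definition lpos P (i : nat) : nat := (sumn (shape (take i P))).+1.
Definition rpos P (i : nat) : nat := sumn (shape (take i.+1 P)).

Definition starts_in P Q (i : nat) : nat :=
  #|[set j : 'I_(size Q) | lpos P i <= lpos Q j <= rpos P i]|.

Definition phrases_with_starts (c : nat) w w' : nat :=
  #|[set i : 'I_(size (lz77 w)) | starts_in (lz77 w) (lz77 w') i == c]|.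

End LZ77.

Definition hamming (T : eqType) (n : nat) (w w' : n.-tuple T) : nat :=
  #|[set i : 'I_n | tnth w i != tnth w' i]|.

Definition hamming_ball (Sigma : finType) (n : nat) (w : n.-tuple Sigma)
    (k : nat) : {set n.-tuple Sigma} :=
  [set w' : n.-tuple Sigma | (hamming w w' <= k)%N].

(* For the empty word this is 0 / 0 = 0. *)
Definition p_frac (R : realType) (T : eqType) (c : nat) (w w' : seq T) : R :=
  (phrases_with_starts c w w')%:R / (C_LZ77 w)%:R.

Definition p2 (R : realType) (T : eqType) (w w' : seq T) : R :=
  p_frac R 2 w w'.
Definition p3 (R : realType) (T : eqType) (w w' : seq T) : R :=
  p_frac R 3 w w'.

(* Unlike division on [\bar R], which gives 0 / 0 = 0 * +oo = 0, this is +oo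
   for every numerator when the denominator is 0. *)
Definition div_oo (R : realType) (a b : R) : \bar R :=
  if b == 0 then +oo%E else (a / b)%:E.

(* Main.v *)
(* Let P be a phrase of w without modified position. Up to its last letter, P is a
   copy of an earlier factor of w, its source. A phrase Q of w' contained in P before
   that letter is new in w', so its image in the source crosses a modified position.

   Two starts: P contains such a Q, determined by the modified position, the length
   of Q and the offset in Q, so at most k l of them have length l. Since the lengths
   of the phrases of w add up to n, splitting at length (n / k)^(1/3) gives
   O(k^(1/3) n^(2/3)).

   Three starts: P contains two consecutive Q, Q', whose images lie on both sides of
   a gap between consecutive modified positions. Among the P with the same gap, the
   images of Q Q' are strictly nested and grow with P, so N of them have total length
   at least N^2; the Cauchy-Schwarz inequality over the gaps gives O(sqrt (k n)).

   Phrases of w with a modified position are at most k in number. *)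
Require Import Defs.
From mathcomp Require Import all_boot all_order all_algebra.
From mathcomp Require Import all_classical all_reals all_analysis.
From mathcomp Require Import zify ring.

Set Implicit Arguments.
Unset Strict Implicit.
Unset Printing Implicit Defensive.

Import Order.TTheory GRing.Theory Num.Theory.
Local Open Scope ring_scope.

(** * Finite counting inequalities *)

Section Counting.
Local Open Scope nat_scope.

(** Choosing one related [j] for each [i] gives an injection; later counts need only a relation
    between phrases and codes. *)
Lemma card_le_rel (I J : finType) (A : {set I}) (B : {set J}) (r : I -> J -> Prop) :
  (forall i, i \in A -> exists2 j, j \in B & r i j) ->
  (forall i i' j, i \in A -> i' \in A -> r i j -> r i' j -> i = i') ->
  #|A| <= #|B|.
Proof.
move=> rex runiq; have [->|[i0 i0A]] := set_0Vmem A; first by rewrite cards0.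
have [j0 _ _] := rex i0 i0A.
have /choice[f fP] : forall i, exists j, i \in A -> j \in B /\ r i j.
  move=> i; case: (boolP (i \in A)) => [/rex[j jB rij]|]; first by exists j.
  by exists j0.
rewrite -(@card_in_imset _ _ f) => [|i i' iA i'A eq].
  by apply/subset_leq_card/fintype.subsetP => _ /imsetP[i iA ->]; have [] := fP i iA.
have [_ ri] := fP i iA; have [_ ri'] := fP i' i'A.
by apply: (runiq _ _ (f i)) => //; rewrite eq.
Qed.

Lemma sqr_sum_le (I : finType) (A : {set I}) (f : I -> nat) :
  (\sum_(i in A) f i) ^ 2 <= #|A| * \sum_(i in A) f i ^ 2.
Proof.
rewrite -(@leq_pmul2l 2) // -[X in 2 * X <= _]mulnn big_distrlr /= big_distrr /=.
apply: (@leq_trans (\sum_(i in A) \sum_(j in A) (f i ^ 2 + f j ^ 2))).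
  apply: leq_sum => i _; rewrite big_distrr /=; apply: leq_sum => j _.
  exact: nat_Cauchy.
under eq_bigr => i _ do rewrite big_split /= sum_nat_const.
by rewrite big_split /= sum_nat_const -big_distrr /= mul2n addnn.
Qed.

(** Distinct naturals sum to at least 0 + 1 + ... + (m - 1). The induction removes an index of
    largest value. *)
Lemma sum_inj_ge (I : finType) (A : {set I}) (f : I -> nat) :
  {in A &, injective f} -> #|A| * #|A|.-1 <= 2 * \sum_(i in A) f i.
Proof.
move En : #|A| => m; elim: m A En => [|m IH] A Am finj //.
have /card_gt0P[i0 i0A] : 0 < #|A| by rewrite Am.
case: (arg_maxnP f i0A) => i iA_ imax; have {iA_} iA : i \in A by [].
have cA : #|A :\ i| = m by move: Am; rewrite (cardsD1 i) iA add1n => -[].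
(* Pigeonhole: [m + 1] distinct values lie between 0 and [f i]. *)
have mf : m <= f i.
  rewrite -ltnS -Am -(card_ord (f i).+1).
  apply: (@leq_card_in _ _ (fun j => inord (f j))) => j j' jA j'A /(congr1 val) /=.
  rewrite !inordK ?ltnS; [exact: finj | exact: imax | exact: imax].
rewrite (big_setD1 i) //=.
have : m * m.-1 <= 2 * \sum_(j in A :\ i) f j.
  by apply: IH => // j j' /setD1P[_ jA] /setD1P[_ j'A]; apply: finj.
by case: m mf {IH Am cA} => [|m] /=; nia.
Qed.

End Counting.

(** * Copy and novelty properties of the greedy parse, in terms of positions *)

Section Parsing.
Local Open Scope nat_scope.
Variable T : eqType.
Implicit Types (s u v w : seq T) (P : seq (seq T)).

Lemma phrase_length_gt0 u v : 0 < size v -> 0 < phrase_length u v.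
Proof. by move=> v0; rewrite leq_min v0. Qed.

Lemma phrase_length_source u v : infix (take (phrase_length u v).-1 v) u.
Proof.
rewrite /phrase_length; set a := (fun _ => _); set f := find _ _.
set l := minn _ _; case E : l.-1 => [|m]; first by rewrite take0 infix0s.
have mf : m < f by rewrite /l in E; lia.
have ms : m < size v by rewrite /l in E; lia.
have := before_find 0 mf.
by rewrite nth_iota // add1n /a => /negbFE.
Qed.

(** A phrase shorter than [v] was stopped by the search, not by the end of the word. *)
Lemma phrase_length_novel u v : phrase_length u v < size v ->
  ~~ infix (take (phrase_length u v) v) u.
Proof.
rewrite /phrase_length; set a := (fun _ => _); set f := find _ _ => lt.
have -> : minn (size v) f.+1 = f.+1 by lia.
have fs : f < size v by lia.
have : has a (iota 1 (size v)) by rewrite has_find size_iota.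
by move/(nth_find 0); rewrite -/f nth_iota // add1n.
Qed.

Lemma lz77_rec_flatten fuel u v : size v <= fuel ->
  flatten (lz77_rec fuel u v) = v.
Proof.
elim: fuel u v => [|m IH] u [|x v] //= vm.
set l := phrase_length _ _.
have l0 : 0 < l by apply: phrase_length_gt0.
rewrite IH ?cat_take_drop // size_drop /=; lia.
Qed.

Lemma lz77_rec_source fuel u v i : i < size (lz77_rec fuel u v) ->
  let p := nth [::] (lz77_rec fuel u v) i in
  infix (take (size p).-1 p) (u ++ flatten (take i (lz77_rec fuel u v))).
Proof.
elim: fuel u v i => [|m IH] u [|x v] //= i.
set l := phrase_length _ _; case: i => [_|i] /=; last first.
  by rewrite ltnS => /IH; rewrite -catA.
have ls : l <= size (x :: v) by apply: geq_minl.
rewrite cats0 size_takel // take_takel ?leq_pred //.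
exact: phrase_length_source.
Qed.

Lemma lz77_rec_novel fuel u v i : size v <= fuel ->
  i.+1 < size (lz77_rec fuel u v) ->
  ~~ infix (nth [::] (lz77_rec fuel u v) i)
           (u ++ flatten (take i (lz77_rec fuel u v))).
Proof.
elim: fuel u v i => [|m IH] u [|x v] //= i vm.
set l := phrase_length _ _; case: i => [|i] /=; rewrite ltnS; last first.
  move/IH; rewrite -catA; apply; rewrite size_drop /=.
  have : 0 < l by apply: phrase_length_gt0.
  lia.
move=> sz; rewrite cats0; apply: phrase_length_novel; rewrite -/l ltnNge.
(* A phrase filling [v] would leave nothing for a second phrase. *)
by apply/negP => le; move: sz; rewrite drop_oversize //; case: (m).
Qed.

Lemma lz77_rec_nonempty fuel u v i : i < size (lz77_rec fuel u v) ->
  0 < size (nth [::] (lz77_rec fuel u v) i).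
Proof.
elim: fuel u v i => [|m IH] u [|x v] //= [|i] /=; last by rewrite ltnS; apply: IH.
by move=> _; rewrite size_take_min leq_min phrase_length_gt0.
Qed.

Lemma infix_nthP x0 s u : reflect
  (exists2 o, o + size s <= size u &
     forall t, t < size s -> nth x0 u (o + t) = nth x0 s t)
  (infix s u).
Proof.
apply: (iffP idP) => [/infixP[p [q ->]] | [d os E]].
  exists (size p) => [|t ts]; first by rewrite !size_cat; lia.
  by rewrite nth_cat ltnNge leq_addr /= addKn nth_cat ts.
apply/infixP; exists (take d u), (drop (d + size s) u).
rewrite -[LHS](cat_take_drop d); congr (_ ++ _).
rewrite -[LHS](cat_take_drop (size s)) drop_drop addnC; congr (_ ++ _).
apply: (@eq_from_nth _ x0) => [|t]; rewrite size_takel ?size_drop //; try lia.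
by move=> ts; rewrite nth_take // nth_drop E.
Qed.

(** With positions counted from 0, phrase [i] is the half-open interval from [phrase_start w i] to
    [phrase_start w i.+1]; these ends are [(lpos (lz77 w) i).-1] and [rpos (lz77 w) i]. *)
Definition phrase_start w i := sumn (shape (take i (lz77 w))).

Lemma lz77_flatten w : flatten (lz77 w) = w.
Proof. exact: lz77_rec_flatten. Qed.

Lemma phrase_startS w i : i < C_LZ77 w ->
  phrase_start w i.+1 = phrase_start w i + size (nth [::] (lz77 w) i).
Proof.
move=> iz; rewrite /phrase_start (take_nth [::]) // /shape map_rcons.
by rewrite -cats1 sumn_cat /= addn0.
Qed.

Lemma phrase_start_lt w i : i < C_LZ77 w -> phrase_start w i < phrase_start w i.+1.
Proof.
by move=> iz; rewrite phrase_startS // -addn1 leq_add2l lz77_rec_nonempty.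
Qed.

Lemma phrase_start_le w i j : i <= j -> phrase_start w i <= phrase_start w j.
Proof.
move=> ij; rewrite /phrase_start -(subnKC ij) takeD /shape map_cat sumn_cat.
exact: leq_addr.
Qed.

Lemma phrase_start_last w : phrase_start w (C_LZ77 w) = size w.
Proof. by rewrite /phrase_start take_size -size_flatten lz77_flatten. Qed.

Lemma phrase_start_size w i : phrase_start w i <= size w.
Proof.
rewrite -phrase_start_last; case: (leqP i (C_LZ77 w)) => [|/ltnW] iz.
  exact: phrase_start_le.
by rewrite /phrase_start take_oversize // take_size.
Qed.

Lemma flatten_take_phrases w i : flatten (take i (lz77 w)) = take (phrase_start w i) w.
Proof.
rewrite /phrase_start -size_flatten -{3}(lz77_flatten w).
by rewrite -{3}(cat_take_drop i (lz77 w)) flatten_cat take_size_cat.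
Qed.

Lemma nth_phrase x0 w i t : i < C_LZ77 w -> t < size (nth [::] (lz77 w) i) ->
  nth x0 (nth [::] (lz77 w) i) t = nth x0 w (phrase_start w i + t).
Proof.
move=> iz ts; rewrite -{2}(lz77_flatten w).
rewrite -{2}(cat_take_drop i (lz77 w)) flatten_cat (drop_nth [::]) //=.
rewrite nth_cat size_flatten -/(phrase_start w i) ltnNge leq_addr /= addKn.
by rewrite nth_cat ts.
Qed.

Lemma phrase_source x0 w i : i < C_LZ77 w -> exists2 o,
  o + (phrase_start w i.+1 - phrase_start w i).-1 <= phrase_start w i &
  forall t, t < (phrase_start w i.+1 - phrase_start w i).-1 ->
    nth x0 w (o + t) = nth x0 w (phrase_start w i + t).
Proof.
move=> iz; have := @lz77_rec_source _ _ _ _ iz.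
rewrite cat0s -/(lz77 w) flatten_take_phrases phrase_startS // addKn.
set p := nth _ _ _; move=> /(infix_nthP x0)[ o].
rewrite size_takel ?leq_pred // size_takel ?phrase_start_size // => os E.
exists o => // t ts; have := E t ts.
rewrite !nth_take //; last by lia.
by move=> ->; apply: nth_phrase => //; rewrite -/p; lia.
Qed.

(** Stated as a contradiction because the exclusion arguments below all exhibit an earlier copy of a
    whole phrase. The last phrase is exempt: it may be a repetition. *)
Lemma phrase_novel x0 w i o : i.+1 < C_LZ77 w ->
  o + (phrase_start w i.+1 - phrase_start w i) <= phrase_start w i ->
  (forall t, t < phrase_start w i.+1 - phrase_start w i ->
    nth x0 w (o + t) = nth x0 w (phrase_start w i + t)) -> False.
Proof.
move=> iz; have iz' := ltnW iz; rewrite phrase_startS // addKn => os E.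
have /negP := @lz77_rec_novel _ [::] _ _ (leqnn _) iz; apply.
rewrite cat0s -/(lz77 w) flatten_take_phrases; apply/(infix_nthP x0).
exists o => [|t ts]; first by rewrite size_takel ?phrase_start_size.
by rewrite nth_take ?E ?nth_phrase //; lia.
Qed.

Lemma sum_phrase_lengths w (A : {set 'I_(C_LZ77 w)}) :
  \sum_(i in A) (phrase_start w i.+1 - phrase_start w i) <= size w.
Proof.
apply: (@leq_trans (\sum_(i < C_LZ77 w) (phrase_start w i.+1 - phrase_start w i))).
  by rewrite [leqRHS](bigID (mem A)) leq_addr.
rewrite -(big_mkord xpredT (fun i => phrase_start w i.+1 - phrase_start w i)).
by rewrite telescope_sumn ?phrase_start_last ?leq_subr //; apply: phrase_start_le.
Qed.

(** Starts increase with the index. If the least and greatest of the [c] indices differed by less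
    than [c - 1], there would be too few indices between them. *)
Lemma starts_in_consecutive w w' c (i : nat) : 0 < c ->
  starts_in (lz77 w) (lz77 w') i = c -> exists j,
  [/\ j + c.-1 < C_LZ77 w', phrase_start w i <= phrase_start w' j &
      phrase_start w' (j + c.-1) < phrase_start w i.+1].
Proof.
rewrite /starts_in => c0; set B := [set _ | _] => Bc.
have /card_gt0P[j0 j0B] : 0 < #|B| by rewrite Bc.
case: (arg_minnP (fun j : 'I__ => val j) j0B) => j jB jmin.
case: (arg_maxnP (fun j : 'I__ => val j) j0B) => m mB mmax.
have jm : j + c.-1 <= m.
  rewrite leqNgt; apply/negP => lt.
  suff : #|B| <= m.+1 - j by have := jmin _ mB; rewrite Bc; lia.
  rewrite -(size_iota j (m.+1 - j)) cardE -(size_map val).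
  apply: uniq_leq_size; first by rewrite (map_inj_uniq val_inj) enum_uniq.
  move=> _ /mapP[x /[!mem_enum] xB ->]; rewrite mem_iota.
  have := jmin _ xB; have := mmax _ xB => /=; lia.
have : j \in B /\ m \in B by [].
rewrite /B !finset.inE => -[/andP[jl _] /andP[_ mr]]; exists j; split=> //.
  exact: leq_ltn_trans jm (ltn_ord m).
exact: leq_ltn_trans (phrase_start_le _ jm) mr.
Qed.

End Parsing.

(** * Phrases of [w] against phrases of [w'] *)

Section Comparison.
Local Open Scope nat_scope.
Variables (T : eqType) (x0 : T) (n : nat) (w w' : n.-tuple T).
Local Notation st := (phrase_start w).
Local Notation st' := (phrase_start w').

Definition modified : {set 'I_n} := [set i | tnth w i != tnth w' i].

Lemma unmodified_nth d : (forall i : 'I_n, i \in modified -> nat_of_ord i != d) ->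
  nth x0 w d = nth x0 w' d.
Proof.
move=> md; case: (ltnP d n) => dn; last by rewrite !nth_default ?size_tuple.
apply/eqP/negPn/negP => neq; have := md (Ordinal dn).
by rewrite finset.inE !(tnth_nth x0) => /(_ neq)/eqP.
Qed.

Definition touched (i : nat) := [exists d in modified, st i <= d < st i.+1].

Lemma card_touched (A : {set 'I_(C_LZ77 w)}) :
  (forall i, i \in A -> touched i) -> #|A| <= #|modified|.
Proof.
move=> At.
apply: (@card_le_rel _ _ A modified (fun i d => st i <= d < st i.+1)).
  by move=> i /At/existsP[d /andP[dm dS]]; exists d.
move=> i i' d _ _; wlog lt : i i' / i < i' => [IH ri ri'|].
  case: (ltngtP i i') => [lt|lt|/val_inj//]; first exact: IH lt ri ri'.
  exact/esym/(IH _ _ lt ri' ri).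
have := phrase_start_le w lt; lia.
Qed.

(** The source in [w] spells the phrase as it reads in [w']. An image free of modified positions
    would also stand in [w'], ending before [st' j], so the phrase [j] of [w'] would not be new. *)
Lemma untouched_source i : i < C_LZ77 w -> ~~ touched i -> exists o,
  (forall t, t < (st i.+1 - st i).-1 -> nth x0 w (o + t) = nth x0 w' (st i + t)) /\
  (forall j, st i <= st' j -> st' j.+1 < st i.+1 -> j.+1 < C_LZ77 w' ->
     exists2 d, d \in modified & o + (st' j - st i) <= d < o + (st' j.+1 - st i)).
Proof.
move=> iz /existsPn untch; have [ o os E] := phrase_source x0 iz.
have E' t : t < (st i.+1 - st i).-1 -> nth x0 w (o + t) = nth x0 w' (st i + t).
  move=> ts; rewrite E //; apply: unmodified_nth => d dm.
  by apply/eqP => ed; have := untch d; rewrite dm /= ed; lia.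
exists o; split=> // j ij ji jz.
case: (boolP [exists d in modified, o + (st' j - st i) <= d < o + (st' j.+1 - st i)]).
  by move=> /existsP[d /andP[dm dS]]; exists d.
move=> /existsPn unm; exfalso; have := phrase_start_lt (ltnW jz) => jlt.
apply: (phrase_novel (x0 := x0) (o := o + (st' j - st i)) jz).
  by lia.
move=> t => ts; rewrite -unmodified_nth => [|d dm].
  rewrite -addnA E'; last by lia.
  by congr nth; lia.
by apply/eqP => ed; have := unm d; rewrite dm /= ed; lia.
Qed.

(* [al, al + l) is the image, in the source of the i-th phrase of w, of a phrase
   of w' lying inside that i-th phrase. *)
Definition fresh_block i al l := exists j,
  [/\ j.+1 < C_LZ77 w', st i <= st' j, st' j.+1 < st i.+1, l = st' j.+1 - st' j &
   (exists2 d, d \in modified & al <= d < al + l) /\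
   (forall t, t < l -> nth x0 w (al + t) = nth x0 w' (st' j + t))].

(** The second start lies in the phrase of [w], so the phrase of [w'] before it avoids the last
    letter, which is not copied, and is not the final phrase of [w']. *)
Lemma fresh_block_exists (i : 'I_(C_LZ77 w)) :
  starts_in (lz77 w) (lz77 w') i = 2 -> ~~ touched i ->
  exists al l, fresh_block i al l.
Proof.
move=> /starts_in_consecutive[]// j [/=]; rewrite addn1 => jz ij ji unt.
have [ o [E /(_ j ij ji jz)[d dm dS]]] := untouched_source (ltn_ord i) unt.
have := phrase_start_lt (ltnW jz) => jlt.
exists (o + (st' j - st i)), (st' j.+1 - st' j), j; split=> //; split.
  by exists d => //; lia.
move=> t ts; rewrite -addnA E; last by lia.
by congr nth; lia.
Qed.

(** Both phrases of [w'] spell the same factor of [w], so the later one would repeat the earlier. *)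
Lemma fresh_block_inj (i i' : 'I_(C_LZ77 w)) al l :
  fresh_block i al l -> fresh_block i' al l -> i = i'.
Proof.
wlog lt : i i' / i < i' => [IH ri ri'|].
  case: (ltngtP i i') => [lt|lt|/val_inj//]; first exact: IH lt ri ri'.
  exact/esym/(IH _ _ lt ri' ri).
move=> [j [jz ij ji lj [_ E]]] [j' [jz' ij' ji' lj' [_ E']]]; exfalso.
have := phrase_start_le w lt => Sii.
have := phrase_start_lt (ltnW jz) => jlt.
apply: (phrase_novel (x0 := x0) (o := st' j) jz'); rewrite -lj'; first by lia.
by move=> t tl; rewrite -E // E'.
Qed.

(** The terms count touched phrases, phrases with a block of length at most [L], and phrases with a
    longer block. *)
Lemma two_starts_bound L :
  phrases_with_starts 2 w w' <= #|modified| + #|modified| * L ^ 2 + n %/ L.+1.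
Proof.
rewrite /phrases_with_starts; set A := [set _ | _].
rewrite -(cardsID [set i : 'I_(C_LZ77 w) | touched i] A) -addnA leq_add //.
  by apply: card_touched => i /setIP[_]; rewrite finset.inE.
set U := _ :\: _.
have UP i : i \in U -> exists al l, fresh_block i al l.
  by rewrite !finset.inE => /andP[unt /eqP st]; apply: fresh_block_exists.
have /choice[f fP] : forall i, exists y : nat * nat, i \in U -> fresh_block i y.1 y.2.
  move=> i; case: (boolP (i \in U)) => [/UP[al [l H]]|_]; first by exists (al, l).
  by exists (0, 0).
rewrite -(cardsID [set i | (f i).2 <= L] U) leq_add //; last first.
  rewrite leq_divRL // -sum_nat_const.
  rewrite -[leqRHS](size_tuple w).
  apply: leq_trans (sum_phrase_lengths (U :\: [set i | (f i).2 <= L])).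
  apply: leq_sum => i /setDP[/fP[j [_ ij ji lj _]]]; rewrite finset.inE -ltnNge => Ll.
  lia.
have -> : #|modified| * L ^ 2 = #|finset.setX modified [set: 'I_L * 'I_L]|.
  by rewrite cardsX cardsT card_prod card_ord mulnn.
(* A short block is coded by a modified position in it, its length minus one and the offset of that
   position; the code determines [al] and [l]. *)
apply: (@card_le_rel _ _ _ _ (fun i y =>
    (f i).2 = (val y.2.1).+1 /\ (f i).1 + val y.2.2 = val y.1)).
  move=> i /setIP[/fP fi]; rewrite finset.inE => fL.
  have [j [_ _ _ _ [[d dm dS] _]]] := fi.
  have l1 : (f i).2.-1 < L by lia.
  have l2 : d - (f i).1 < L by lia.
  exists (d, (Ordinal l1, Ordinal l2)).
    by rewrite finset.in_setX dm finset.in_setT.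
  by split=> /=; lia.
move=> i i' [d [a b]] /= /setIP[/fP fi _] /setIP[/fP fi' _] [e1 e2] [e1' e2'].
have eal : (f i).1 = (f i').1 by lia.
by rewrite e1 eal -e1' e1' in fi *; rewrite e1' in fi'; apply: fresh_block_inj fi fi'.
Qed.

(* [al, be) and [be, ga) are the source images of two consecutive phrases of w',
   and [p] is the last modified position in the first one. *)
Definition fresh_pair i p al be ga := exists j,
  [/\ j.+2 < C_LZ77 w', st i <= st' j, st' j.+2 < st i.+1,
      be = al + (st' j.+1 - st' j) /\ ga = al + (st' j.+2 - st' j) &
   [/\ p \in modified, al <= p < be,
     (forall d, d \in modified -> p < d -> be <= d),
     (exists2 q, q \in modified & be <= q < ga) &
     (forall t, t < ga - al -> nth x0 w (al + t) = nth x0 w' (st' j + t))]].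

Lemma fresh_pair_exists (i : 'I_(C_LZ77 w)) :
  starts_in (lz77 w) (lz77 w') i = 3 -> ~~ touched i ->
  exists p al be ga, fresh_pair i p al be ga.
Proof.
move=> /starts_in_consecutive[]// j [/=]; rewrite addn2 => jz ij ji unt.
have jz1 := ltnW jz.
have := phrase_start_lt (ltnW jz1) => jlt.
have := phrase_start_lt jz1 => jlt1.
have [ o [E dex]] := untouched_source (ltn_ord i) unt.
have [|q qm qS] := dex j.+1 _ ji jz; first lia.
have [|d dm dS] := dex j ij _ jz1; first lia.
set al := o + (st' j - st i); set be := o + (st' j.+1 - st i).
set ga := o + (st' j.+2 - st i).
have dB : (d \in modified) && (al <= d < be) by rewrite dm.
(* The last modified position of the first image names the gap that contains the boundary [be]. *)
case: (arg_maxnP (P := fun d => (d \in modified) && (al <= d < be)) val dB).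
move=> p /andP[pm pS] pmax.
exists p, al, be, ga, j; split=> //; first by rewrite /be /ga /al; lia.
split=> //; last 2 first.
- by exists q.
- move=> t ts; rewrite -addnA E; last by rewrite /ga /al in ts; lia.
  by congr nth; lia.
move=> e em pe; rewrite leqNgt; apply/negP => eb.
by have := pmax e; rewrite em /= eb andbT => /(_ _)/wrap[]; lia.
Qed.

(** As [q] is modified and beyond [p], [be' <= q < ga]. Were [al <= al'], the first phrase of the
    later pair would be copied from the earlier pair; were [ga' <= ga], the second would be, since
    [al <= p < be']. *)
Lemma fresh_pair_nested (i i' : 'I_(C_LZ77 w)) p al be ga al' be' ga' : i < i' ->
  fresh_pair i p al be ga -> fresh_pair i' p al' be' ga' -> al' < al /\ ga < ga'.
Proof.
move=> lt [j [jz ij ji [lb lg] [pm pS pn [q qm qS] E]]].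
move=> [j' [jz' ij' ji' [lb' lg'] [_ pS' pn' _ E']]].
have := phrase_start_le w lt => Sii.
have := phrase_start_lt (ltnW (ltnW jz)) => jlt.
have := phrase_start_lt (ltnW jz) => jlt1.
have := phrase_start_lt (ltnW (ltnW jz')) => jlt'.
have := phrase_start_lt (ltnW jz') => jlt1'.
have bq : be' <= q by apply: pn' => //; lia.
split; rewrite ltnNge; apply/negP => le.
- apply: (phrase_novel (x0 := x0) (o := st' j + (al' - al)) (ltnW jz')).
    lia.
  move=> t ts; rewrite -E'; last by lia.
  rewrite -addnA -E; last by lia.
  by congr nth; lia.
- apply: (phrase_novel (x0 := x0) (o := st' j + (be' - al)) jz').
    lia.
  move=> t ts; rewrite -addnA -E; last by lia.
  have -> : st' j'.+1 + t = st' j' + (be' - al' + t) by lia.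
  rewrite -E'; last by lia.
  by congr nth; lia.
Qed.

(* Nestedness makes both [p - al] and [ga - p] injective on [A], which gives the
   square. *)
Lemma fresh_pairs_sum (A : {set 'I_(C_LZ77 w)}) p
    (f : 'I_(C_LZ77 w) -> nat * nat * nat) :
  (forall i, i \in A -> fresh_pair i p (f i).1.1 (f i).1.2 (f i).2) ->
  #|A| ^ 2 <= \sum_(i in A) (st i.+1 - st i).
Proof.
(* [a] and [g] count the positions of the image before and after [p], so [a i + g i + 1] is its
   length. *)
move=> fP; pose a i := (p : nat) - (f i).1.1; pose g i := ((f i).2 - p).-1.
have le i : i \in A -> [/\ (f i).1.1 <= p, p < (f i).2 &
    a i + g i + 1 <= st i.+1 - st i].
  move=> /fP[j [_ ij ji [lb lg] [_ pS _ [q _ qS] _]]]; rewrite /a /g; split; lia.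
have nest i i' : i \in A -> i' \in A -> i < i' -> a i < a i' /\ g i < g i'.
  move=> iA i'A lt; have := fresh_pair_nested lt (fP _ iA) (fP _ i'A).
  have [? ? _] := le _ iA; have [? ? _] := le _ i'A; rewrite /a /g; lia.
have inja : {in A &, injective a}.
  move=> i i' iA i'A eq; case: (ltngtP i i') => [lt|lt|/val_inj//].
    by have := nest _ _ iA i'A lt; lia.
  by have := nest _ _ i'A iA lt; lia.
have injg : {in A &, injective g}.
  move=> i i' iA i'A eq; case: (ltngtP i i') => [lt|lt|/val_inj//].
    by have := nest _ _ iA i'A lt; lia.
  by have := nest _ _ i'A iA lt; lia.
apply: (@leq_trans (\sum_(i in A) (a i + g i + 1))).
  rewrite !big_split /= sum1_card.
  (* Each sum is at least [m * (m - 1) / 2]; the ones add [m], giving [m ^ 2]. *)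
  by have := sum_inj_ge inja; have := sum_inj_ge injg; case: #|A| => // m /=; nia.
by apply: leq_sum => i /le[].
Qed.

(** [M] and [U] count touched and untouched phrases, [V] is the total length of the latter. Three
    starts force length at least 3, and a fresh pair has two distinct modified positions [p] and
    [q]. *)
Lemma three_starts_bound : exists M U V,
  [/\ phrases_with_starts 3 w w' = M + U, M <= #|modified|, 3 * M + V <= n,
      U ^ 2 <= #|modified| * V & (0 < U -> 1 < #|modified|)].
Proof.
rewrite /phrases_with_starts; set A := [set _ | _].
set B := [set i : 'I_(C_LZ77 w) | touched i].
rewrite -(cardsID B A); set U := A :\: B.
exists #|A :&: B|, #|U|, (\sum_(i in U) (st i.+1 - st i)); split=> //.
- by apply: card_touched => i /setIP[_]; rewrite finset.inE.
- apply: (@leq_trans (\sum_(i in A) (st i.+1 - st i))); last first.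
    by rewrite -[leqRHS](size_tuple w) sum_phrase_lengths.
  rewrite [leqRHS](big_setID B) leq_add2r mulnC -sum_nat_const.
  apply: leq_sum => i /setIP[+ _]; rewrite finset.inE => /eqP.
  move=> /starts_in_consecutive[]// j [/=]; rewrite addn2 => jz ij ji.
  have := phrase_start_lt (ltnW jz); have := phrase_start_lt (ltnW (ltnW jz)); lia.
- have UP i : i \in U -> exists p al be ga, fresh_pair i p al be ga.
    by rewrite !finset.inE => /andP[unt /eqP st]; apply: fresh_pair_exists.
  have [->|[i0 /UP[p0 _]]] := set_0Vmem U; first by rewrite cards0.
  have /choice[f fP] : forall i, exists y : 'I_n * (nat * nat * nat), i \in U ->
      fresh_pair i y.1 y.2.1.1 y.2.1.2 y.2.2.
    move=> i; case: (boolP (i \in U)) => [/UP[p [al [be [ga H]]]]|_].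
      by exists (p, (al, be, ga)).
    by exists (p0, (0, 0, 0)).
  have fm i : i \in U -> (f i).1 \in modified by move=> /fP[j [_ _ _ _ []]].
  rewrite -sum1_card !(partition_big (fun i => (f i).1) (mem modified)) //=.
  apply: leq_trans (sqr_sum_le _ _) _; rewrite leq_mul2l; apply/orP; right.
  apply: leq_sum => p _.
  rewrite sum1dep_card.
  rewrite -(eq_bigl _ _ (finset.in_set (fun i => (i \in U) && ((f i).1 == p)))).
  apply: (@fresh_pairs_sum _ p (fun i => (f i).2)) => i.
  by rewrite finset.in_set => /andP[/fP fi /eqP <-].
- move=> /card_gt0P[i]; rewrite !finset.inE => /andP[unt /eqP /fresh_pair_exists].
  move=> /(_ unt)[p [al [be [ga [j [_ _ _ _ [pm pS _ [q qm qS] _]]]]]]].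
  rewrite (cardD1 p) pm (cardD1 q) finset.inE /= qm andbT.
  by have -> : q != p by apply/eqP => eq; rewrite eq in qS; lia.
Qed.

End Comparison.

(** * Arithmetic of the two counting bounds *)

Section NatBounds.
Local Open Scope nat_scope.

(** For a suitable [L] each of the three terms has cube at most [h * n ^ 2]; 27 is the cube of the
    number of terms. *)
Lemma cubic_bound N h n : h <= n ->
  (forall L, N <= h + h * L ^ 2 + n %/ L.+1) -> N ^ 3 <= 27 * (h * n ^ 2).
Proof.
case: (posnP h) => [-> _ /(_ n)|h0 hn NL].
  by rewrite divn_small // leqn0 => /eqP->.
(* [L] is the integer part of the cube root of [n / h], which balances the last two terms. *)
have [L /andP[Ln nL]] : exists L, (h * L ^ 3 <= n < h * L.+1 ^ 3).
  have [|n0 |L Ln Lmax] := @ex_maxnP (fun L => h * L ^ 3 <= n) n.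
  - by exists 0; rewrite muln0.
  - by move=> H; nia.
  - by exists L; rewrite Ln ltnNge; apply/negP => /Lmax; rewrite ltnn.
set X := h * n ^ 2.
have aX : h ^ 3 <= X by rewrite /X expnS leq_mul2l leq_sqr hn orbT.
have bX : (h * L ^ 2) ^ 3 <= X.
  have -> : (h * L ^ 2) ^ 3 = h * (h * L ^ 3) ^ 2 by ring.
  by rewrite /X leq_mul2l leq_sqr Ln orbT.
have cX : (n %/ L.+1) ^ 3 <= X.
  have n0 : 0 < n by apply: leq_trans hn.
  rewrite -(leq_pmul2l n0).
  apply: (@leq_trans (h * L.+1 ^ 3 * (n %/ L.+1) ^ 3)).
    by rewrite leq_mul2r ltnW ?orbT.
  rewrite -mulnA -expnMn.
  have -> : n * X = h * n ^ 3 by rewrite /X; ring.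
  by rewrite leq_mul2l leq_exp2r // mulnC leq_trunc_div orbT.
have := NL L; move: (h * L ^ 2) (n %/ L.+1) bX cX => b c bX cX Nle.
pose m := maxn h (maxn b c).
have mX : m ^ 3 <= X by rewrite /m /maxn; do 2 case: ifP.
apply: (@leq_trans ((3 * m) ^ 3)); first by rewrite leq_exp2r // /m; lia.
by rewrite expnMn leq_mul2l.
Qed.

Lemma quadratic_bound M U V h n : M <= h -> 3 * M + V <= n -> U ^ 2 <= h * V ->
  (0 < U -> 1 < h) -> 2 * (M + U) ^ 2 <= h ^ 3 * n.
Proof.
move=> Mh MV UV hU; case: (ltnP 1 h) => [h1|h1]; last first.
  (* Here [h <= 1], so [M <= 1], and for [h = 1] one has [2 * M ^ 2 <= 3 * M <= n]. *)
  have -> : U = 0 by lia.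
  by case: h Mh h1 UV {hU} => [|[|h]]; case: M MV => [|[|M]] //; nia.
(* The two sides differ by the square of [3 * M - U]. The weights turn [M ^ 2 <= h * M] and
   [U ^ 2 <= h * V] into a multiple of [3 * M + V]. *)
have le1 : 3 * (M + U) ^ 2 <= 12 * M ^ 2 + 4 * U ^ 2.
  by have := leq_of_leqif (nat_Cauchy (3 * M) U); rewrite -!mulnn; nia.
have le2 : M ^ 2 <= h * M by rewrite -mulnn leq_mul2r Mh orbT.
have le3 : 3 * (M + U) ^ 2 <= 4 * (h * n).
  apply: (@leq_trans (4 * (h * (3 * M + V)))); first by lia.
  by rewrite !leq_mul2l MV !orbT.
have le4 : 8 * h <= 3 * h ^ 3 by nia.
have : 8 * h * n <= 3 * h ^ 3 * n by rewrite leq_mul2r le4 orbT.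
lia.
Qed.

End NatBounds.

(** * Passage to real exponents and extended reals *)

(** [C] cancels against the denominator of the fraction, so only a bound on the count [N] is needed;
    a zero fraction gives [+oo]. *)
Lemma le_div_oo_frac (R : realType) (X c : R) (N C : nat) :
  0 < c -> c * N%:R <= X -> (C%:R%:E <= div_oo X (c * (N%:R / C%:R)))%E.
Proof.
move=> c0 NX; rewrite /div_oo; case: ifPn => [_|]; first exact: leey.
rewrite !mulf_eq0 invr_eq0 !negb_or => /and3P[_ N0 C0].
rewrite lee_fin ler_pdivlMr; last first.
  by rewrite mulr_gt0 // divr_gt0 // lt_neqAle eq_sym ?N0 ?C0 ler0n.
by have -> : C%:R * (c * (N%:R / C%:R)) = c * N%:R by field.
Qed.

Lemma powR_exp (R : realType) (a r s : R) m :
  0 <= a -> r * m%:R = s -> (a `^ r) ^+ m = a `^ s.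
Proof. by move=> a0 <-; rewrite powRrM powR_mulrn ?powR_ge0. Qed.

Theorem theorem2 (R : realType) (Sigma : finType) (k n : nat)
    (w w' : n.-tuple Sigma) (hw' : w' \in hamming_ball w k) :
  ((C_LZ77 w)%:R%:E <=
     div_oo (4 * (k%:R `^ (1 / 3) * n%:R `^ (2 / 3))) (p2 R w w'))%E /\
  ((C_LZ77 w)%:R%:E <=
     div_oo (k%:R `^ (3 / 2) * Num.sqrt n%:R) (Num.sqrt 2 * p3 R w w'))%E.
Proof.
have hk : (#|modified w w'| <= k)%N by move: hw'; rewrite finset.inE.
have hn : (#|modified w w'| <= n)%N by rewrite -[leqRHS]card_ord max_card.
have [N2 N3] : ((phrases_with_starts 2 w w') ^ 3 <= 27 * (k * n ^ 2))%N /\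
    (2 * (phrases_with_starts 3 w w') ^ 2 <= k ^ 3 * n)%N.
  (* The empty word has no phrases; otherwise a letter is available as the default of [nth]. *)
  case: n w w' {hw'} hk hn => [|m] w w' hk hn.
    have zero c : phrases_with_starts c w w' = 0.
      apply/eqP; rewrite -leqn0; apply: leq_trans (max_card _) _.
      by rewrite card_ord (tuple0 w).
    by rewrite !zero.
  have x0 := tnth w ord0; split.
    apply: leq_trans (cubic_bound hn (two_starts_bound x0 w w')) _.
    by rewrite leq_mul2l leq_mul2r hk orbT.
  have [M [U [V [-> Mh MV UV hU]]]] := three_starts_bound x0 w w'.
  apply: leq_trans (quadratic_bound Mh MV UV hU) _.
  by rewrite leq_mul2r leq_exp2r // hk orbT.
split.
- rewrite -[p2 R w w']mul1r; apply: le_div_oo_frac => //; rewrite mul1r.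
  rewrite -(@ler_pXn2r _ 3) ?nnegrE ?mulr_ge0 ?powR_ge0 //.
  rewrite !exprMn (@powR_exp _ _ _ 1) ?ler0n //; last by field.
  rewrite (@powR_exp _ _ _ 2) ?ler0n //; last by field.
  rewrite powRr1 // powR_mulrn // -!natrX -!natrM ler_nat.
  (* The constant 4 suffices because 27 is at most its cube, 64. *)
  by apply: leq_trans N2 _; rewrite leq_mul2r orbT.
- apply: le_div_oo_frac; first by rewrite sqrtr_gt0.
  rewrite -(@ler_pXn2r _ 2) ?nnegrE ?mulr_ge0 ?powR_ge0 ?sqrtr_ge0 //.
  rewrite !exprMn !sqr_sqrtr // (@powR_exp _ _ _ 3) ?ler0n //; last by field.
  by rewrite powR_mulrn // -!natrX -!natrM ler_nat.
Qed.
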